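(* There exists an infinitely renormalizable $C^{1+Lip}$ unimodal map $f$ with a quadratic tip which is not $C^2$ but satisfies $$Rf=f.$$
   Context: A unimodal map $f:[0,1]\to[0,1]$ is a $C^1$ map with $f(1)=0$, with a unique point $c\in(0,1)$ (the critical point) where $Df(c)=0$, and with $f(c)=1$. It is $C^{1+Lip}$ if $Df$ is Lipschitz. The critical point $c$ is a quadratic tip if there exist a sequence $x_n\to c$ (with $x_n\neq c$) and a constant $A>0$ such that $\lim_{n\to\infty}\frac{f(x_n)-f(c)}{(x_n-c)^2}=-A$. A unimodal map $f$ with quadratic tip $c$ is renormalizable if (1) $c\in[f^2(c),f^4(c)]=:I_0^1$, (2) $f(I_0^1)=[f^3(c),f(c)]=:I_1^1$, (3) $I_0^1\cap I_1^1=\emptyset$. The renormalization of $f$ is $Rf=h^{-1}\circ f^2\circ h$, where $h:[0,1]\to I_0^1$ is the orientation reversing affine homeomorphism; $Rf$ is again a unimodal map. The map $f$ is infinitely renormalizable if $R^nf$ is defined and renormalizable for all $n\ge0$. *)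

(* Defs.v *)
From Stdlib Require Import Reals Lra ClassicalEpsilon.
Open Scope R_scope.

Definition segment (a b x : R) : Prop := a <= x <= b.

(* A map of [0,1] is given by a total function [f : R -> R]; every notion below
   depends only on the values of [f] on [0,1].  In particular derivatives are
   taken within [0,1], hence are one-sided at the endpoints. *)
Definition I01 : R -> Prop := segment 0 1.

Definition derivative_on_I01 (f f' : R -> R) : Prop :=
  forall x, I01 x -> D_in f f' I01 x.

Fixpoint class_C (k : nat) (f : R -> R) : Prop :=
  match k with
  | O => forall x, I01 x -> continue_in f I01 x
  | S k' => exists f', derivative_on_I01 f f' /\ class_C k' f'
  end.

Definition Lipschitz_on_I01 (g : R -> R) : Prop :=
  exists K, forall x y, I01 x -> I01 y -> Rabs (g x - g y) <= K * Rabs (x - y).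

Definition class_C1_Lip (f : R -> R) : Prop :=
  exists f', derivative_on_I01 f f' /\ Lipschitz_on_I01 f'.

Definition critical_point (f : R -> R) (c : R) : Prop :=
  0 < c < 1 /\ D_in f (fun _ => 0) I01 c.

Definition unimodal (f : R -> R) : Prop :=
  (forall x, I01 x -> I01 (f x)) /\
  class_C 1 f /\
  f 1 = 0 /\
  exists c, unique (critical_point f) c /\ f c = 1.

(* Meaningful only when [f] has a unique critical point, e.g. [f] unimodal. *)
Definition crit (f : R -> R) : R := epsilon (inhabits 0) (critical_point f).

Definition quadratic_tip (f : R -> R) : Prop :=
  let c := crit f in
  exists (x : nat -> R) (A : R),
    0 < A /\
    (forall n, I01 (x n) /\ x n <> c) /\
    Un_cv x c /\
    Un_cv (fun n => (f (x n) - f c) / (x n - c) ^ 2) (- A).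

Definition crit_orbit (f : R -> R) (k : nat) : R := Nat.iter k f (crit f).

(* For unimodal [f] one has [crit_orbit f 1 = 1] and [crit_orbit f 2 = 0], so the
   endpoints of the next two segments are listed in increasing order. *)
Definition I0 (f : R -> R) : R -> Prop :=
  segment (crit_orbit f 2) (crit_orbit f 4).

Definition I1 (f : R -> R) : R -> Prop :=
  segment (crit_orbit f 3) (crit_orbit f 1).

Definition renormalizable (f : R -> R) : Prop :=
  unimodal f /\ quadratic_tip f /\
  I0 f (crit f) /\
  eq_Dom (image_dir f (I0 f)) (I1 f) /\
  ~ (exists x, intersection_domain (I0 f) (I1 f) x).

(* The orientation reversing affine bijection [0,1] -> [a,b] and its inverse. *)
Definition flip (a b x : R) : R := b - (b - a) * x.

Definition flip_inv (a b y : R) : R := (b - y) / (b - a).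

Lemma flipK (a b x : R) : a < b -> flip_inv a b (flip a b x) = x.
Proof. intros Hab. unfold flip_inv, flip. field. lra. Qed.

Lemma flip_invK (a b y : R) : a < b -> flip a b (flip_inv a b y) = y.
Proof. intros Hab. unfold flip_inv, flip. field. lra. Qed.

(* Meaningful only when [f] is renormalizable. *)
Definition renormalization (f : R -> R) (x : R) : R :=
  let a := crit_orbit f 2 in
  let b := crit_orbit f 4 in
  flip_inv a b (f (f (flip a b x))).

Definition infinitely_renormalizable (f : R -> R) : Prop :=
  forall n : nat, renormalizable (Nat.iter n renormalization f).

(* Main.v *)
(* Write f = 1 - g with tip c = 1/3.  If f is affine on [3/4,1], with f(3/4) = 1/2
   and f(1) = 0, then I_0 = [0,1/2], I_1 = [3/4,1], and Rf = f becomes the linear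
   equation g(x) = g(1 - 2x)/4 on [0,1/2]; here x |-> 1 - 2x expands by -2 about c.
   Thus g is determined by its restriction to [1/2,1], which may be chosen freely
   subject to matching g and g' at the ends.  The derivatives s = g' satisfy
   s(x) = -s(1 - 2x)/2, which preserves Lipschitz constants.  Choosing s on [1/2,1]
   piecewise affine with a kink at 7/12 gives a Lipschitz derivative which is not
   differentiable.  Since g(c + (2/3)(-1/2)^n) = 4^-n, the tip is quadratic. *)
Require Import Defs.
From Stdlib Require Import Reals Lra ClassicalEpsilon.
From Coquelicot Require Import Coquelicot.
Open Scope R_scope.

(** * The derivative as a series of rescaled tents *)

(* The tent is the amount by which s exceeds 3x - 1 on [1/2,1].  The linear map
   3x - 1 solves s(x) = -s(1 - 2x)/2 and has the required end values s(0) = -1,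
   s(1) = 2.  The slope 15 is what makes g(1) - g(1/2) = 15/16, i.e. g(1) = 1. *)
Definition tent (x : R) : R := Rmax 0 (Rmin (3 * (1 - x)) (15 * (x - 1 / 2))).

(** Solving r(x) = [tent x] - r(1 - 2x)/2 by iteration gives this series: the n-th iterate of x |->
    1 - 2x is multiplication by (-2)^n about its fixed point 1/3. *)
Definition ripple_term (x : R) (n : nat) : R :=
  (- (1 / 2)) ^ n * tent (1 / 3 + (-2) ^ n * (x - 1 / 3)).

Definition ripple (x : R) : R := Series (ripple_term x).

Definition slope (x : R) : R := 3 * x - 1 + ripple x.

Definition depth (x : R) : R := RInt slope (1 / 3) x.

Definition map_fix (x : R) : R := 1 - depth x.

Ltac minmax := unfold Rmax, Rmin in *; repeat destruct (Rle_dec _ _); try lra.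

Lemma tent_bounds x : 0 <= tent x <= 5 / 4.
Proof. unfold tent. minmax. Qed.

Lemma tent_left x : x <= 1 / 2 -> tent x = 0.
Proof. unfold tent. minmax. Qed.

Lemma tent_right x : 1 <= x -> tent x = 0.
Proof. unfold tent. minmax. Qed.

Lemma is_series_half (k : R) : is_series (fun n => k * (1 / 2) ^ n) (2 * k).
Proof.
  replace (2 * k) with (k * / (1 - 1 / 2)) by field.
  apply (is_series_scal_l (K := R_AbsRing) (V := R_NormedModule) k (fun n => (1 / 2) ^ n)). apply is_series_geom.
  rewrite Rabs_pos_eq; lra.
Qed.

Lemma ripple_term_bound x n : Rabs (ripple_term x n) <= 5 / 4 * (1 / 2) ^ n.
Proof.
  unfold ripple_term. rewrite Rabs_mult, <- RPow_abs, Rabs_Ropp, (Rabs_pos_eq (1 / 2)) by lra.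
  rewrite Rmult_comm. apply Rmult_le_compat_r.
  - apply pow_le; lra.
  - pose proof (tent_bounds (1 / 3 + (-2) ^ n * (x - 1 / 3))).
    rewrite Rabs_pos_eq; lra.
Qed.

Lemma ex_series_ripple_abs x : ex_series (fun n => Rabs (ripple_term x n)).
Proof.
  apply (@ex_series_le R_AbsRing R_CompleteNormedModule _ (fun n => 5 / 4 * (1 / 2) ^ n)).
  - intro n. change (Rabs (Rabs (ripple_term x n)) <= 5 / 4 * (1 / 2) ^ n).
    rewrite Rabs_Rabsolu. apply ripple_term_bound.
  - eexists. apply is_series_half.
Qed.

Lemma ripple_bound x : Rabs (ripple x) <= 5 / 2.
Proof.
  unfold ripple. eapply Rle_trans. { apply Series_Rabs, ex_series_ripple_abs. }
  replace (5 / 2) with (2 * (5 / 4)) by field.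
  rewrite <- (is_series_unique _ _ (is_series_half (5 / 4))).
  apply Series_le.
  - intro n. split. { apply Rabs_pos. } apply ripple_term_bound.
  - eexists. apply is_series_half.
Qed.

Lemma ripple_eq x : ripple x = tent x - ripple (1 - 2 * x) / 2.
Proof.
  unfold ripple. rewrite Series_incr_1 by apply ex_series_Rabs, ex_series_ripple_abs.
  unfold Rminus, Rdiv at 1. f_equal.
  - unfold ripple_term. simpl. rewrite Rmult_1_l. f_equal. ring.
  - rewrite Rmult_comm, Ropp_mult_distr_l, <- Series_scal_l.
    apply Series_ext. intro n. unfold ripple_term.
    replace (1 / 3 + (-2) ^ n * (1 + - (2 * x) - 1 / 3))
      with (1 / 3 + (-2) ^ S n * (x - 1 / 3)) by (simpl; field).
    simpl. field.
Qed.

(* Lets the functional equations, which halve errors, be iterated to the limit. *)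
Lemma geometric_le a b k : (forall n, a <= b + k * (1 / 2) ^ n) -> a <= b.
Proof.
  intro H.
  assert (L : is_lim_seq (fun n => b + k * (1 / 2) ^ n) (b + k * 0)).
  { apply (is_lim_seq_plus' _ _ b (k * 0)). { apply is_lim_seq_const. }
    apply (is_lim_seq_scal_l _ k 0). apply is_lim_seq_geom. rewrite Rabs_pos_eq; lra. }
  rewrite Rmult_0_r, Rplus_0_r in L.
  exact (is_lim_seq_le _ _ a b H (is_lim_seq_const a) L).
Qed.

(** The map x |-> 1 - 2x sends the complement of (0,1) into itself and [tent] vanishes there, so
    each use of [ripple_eq] halves the bound 5/2. *)
Lemma ripple_outside x : x <= 0 \/ 1 <= x -> ripple x = 0.
Proof.
  intro Hx.
  assert (H : forall n y, y <= 0 \/ 1 <= y -> Rabs (ripple y) <= 0 + 5 / 2 * (1 / 2) ^ n).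
  { induction n as [|n IH]; intros y Hy.
    - simpl. pose proof (ripple_bound y). lra.
    - rewrite ripple_eq.
      assert (T : tent y = 0). { destruct Hy; [apply tent_left | apply tent_right]; lra. }
      rewrite T. specialize (IH (1 - 2 * y) ltac:(lra)). simpl.
      replace (0 - ripple (1 - 2 * y) / 2) with (- (1 / 2) * ripple (1 - 2 * y)) by field.
      rewrite Rabs_mult, Rabs_Ropp, (Rabs_pos_eq (1 / 2)) by lra. lra. }
  assert (Rabs (ripple x) <= 0) by (apply geometric_le with (5 / 2); intro n; apply H, Hx).
  pose proof (Rabs_pos (ripple x)). apply Rabs_eq_0. lra.
Qed.

Lemma ripple_right x : 1 / 2 <= x -> ripple x = tent x.
Proof. intro Hx. rewrite ripple_eq, ripple_outside by lra. lra. Qed.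

(** The tent sits to the right of 1/3, so it contributes positively. In the other term of
    [ripple_eq] the factors -1/2 of the value and of the displacement multiply to 1/4: signs persist
    and any negative part shrinks. *)
Lemma ripple_sign x : 0 <= ripple x * (x - 1 / 3).
Proof.
  assert (H : forall n y, - (ripple y * (y - 1 / 3)) <= 0 + 5 / 2 * (1 / 2) ^ n).
  { induction n as [|n IH]; intro y.
    (* The displacement is unbounded, but outside (0,1) the ripple vanishes and inside it the
       displacement is below 1. *)
    - simpl. destruct (Rle_dec y 0). { rewrite ripple_outside by lra. lra. }
      destruct (Rle_dec 1 y). { rewrite ripple_outside by lra. lra. }
      pose proof (ripple_bound y) as B. apply Rabs_le_between in B. nra.
    - rewrite ripple_eq. specialize (IH (1 - 2 * y)). simpl.
      assert (0 <= tent y * (y - 1 / 3)).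
      { destruct (Rle_dec y (1 / 2)). { rewrite tent_left; lra. }
        pose proof (tent_bounds y). apply Rmult_le_pos; lra. }
      assert (0 < (1 / 2) ^ n) by (apply pow_lt; lra). nra. }
  assert (- (ripple x * (x - 1 / 3)) <= 0) by (apply geometric_le with (5 / 2); intro n; apply H).
  lra.
Qed.

(** * Sign and Lipschitz bound of the derivative *)

Lemma slope_eq x : slope x = tent x - slope (1 - 2 * x) / 2.
Proof. unfold slope. rewrite ripple_eq. lra. Qed.

(** The linear part 3x - 1 supplies the left side and [ripple_sign] the rest. Hence 1/3 is the only
    possible zero of [slope]. *)
Lemma slope_sign x : 3 * (x - 1 / 3) ^ 2 <= slope x * (x - 1 / 3).
Proof. pose proof (ripple_sign x). unfold slope. nra. Qed.

Lemma slope_tip : slope (1 / 3) = 0.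
Proof.
  pose proof (slope_eq (1 / 3)) as E. rewrite tent_left in E by lra.
  replace (1 - 2 * (1 / 3)) with (1 / 3) in E by field. lra.
Qed.

Lemma slope_nonneg x : 1 / 3 <= x -> 0 <= slope x.
Proof.
  intro Hx. destruct (Req_dec x (1 / 3)) as [-> | Hne].
  - rewrite slope_tip. lra.
  - pose proof (slope_sign x). nra.
Qed.

(** The graph climbs at rate 18 from 1/2 to the kink at 7/12, stays at 2 up to 1, then follows 3x -
    1. *)
Lemma slope_right x : 1 / 2 <= x -> slope x = Rmax (3 * x - 1) (Rmin 2 (18 * x - 17 / 2)).
Proof. intro Hx. unfold slope. rewrite ripple_right by exact Hx. unfold tent. minmax. Qed.

(** Left of 1/2 the functional equation doubles distances and halves values, so the constant 18
    survives while an additive error halves; right of 1/2 the formula is explicit. The initial error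
    5 is twice the bound on [ripple]. *)
Lemma slope_Lipschitz_le x y : x <= y -> Rabs (slope x - slope y) <= 18 * (y - x).
Proof.
  intro Hxy. apply geometric_le with 5. intro n. revert x y Hxy.
  induction n as [|n IH]; intros x y Hxy.
  - pose proof (ripple_bound x) as Bx. pose proof (ripple_bound y) as By.
    apply Rabs_le_between in Bx. apply Rabs_le_between in By.
    unfold slope. simpl. apply Rabs_le. lra.
  - assert (L : forall u v, u <= v <= 1 / 2 ->
      Rabs (slope u - slope v) <= 18 * (v - u) + 5 * (1 / 2) ^ S n).
    { intros u v Huv. specialize (IH (1 - 2 * v) (1 - 2 * u) ltac:(lra)).
      rewrite (slope_eq u), (slope_eq v), !tent_left by lra. simpl.
      apply Rabs_le_between in IH. apply Rabs_le. lra. }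
    assert (Rt : forall u v, 1 / 2 <= u <= v -> Rabs (slope u - slope v) <= 18 * (v - u)).
    { intros u v Huv. rewrite !slope_right by lra. apply Rabs_le. minmax. }
    assert (0 < (1 / 2) ^ S n) by (apply pow_lt; lra).
    destruct (Rle_dec y (1 / 2)). { apply L. lra. }
    destruct (Rle_dec (1 / 2) x). { specialize (Rt x y ltac:(lra)). lra. }
    specialize (L x (1 / 2) ltac:(lra)). specialize (Rt (1 / 2) y ltac:(lra)).
    apply Rabs_le_between in L. apply Rabs_le_between in Rt. apply Rabs_le. lra.
Qed.

Lemma slope_Lipschitz x y : Rabs (slope x - slope y) <= 18 * Rabs (x - y).
Proof.
  destruct (Rle_dec x y).
  - rewrite (Rabs_left1 (x - y)) by lra. pose proof (slope_Lipschitz_le x y). lra.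
  - rewrite Rabs_minus_sym, (Rabs_pos_eq (x - y)) by lra.
    pose proof (slope_Lipschitz_le y x). lra.
Qed.

Lemma slope_continuity x : continuity_pt slope x.
Proof.
  intros eps Heps. exists (eps / 18). split. { lra. }
  intros y [_ Hy]. simpl in *. unfold Rdist in *.
  pose proof (slope_Lipschitz y x). lra.
Qed.

(** * The primitive: functional equation and explicit values *)

Lemma is_derive_depth x : is_derive depth x (slope x).
Proof.
  assert (Hc : forall y, continuous slope y)
    by (intro y; apply continuity_pt_filterlim, slope_continuity).
  apply is_derive_RInt with (1 / 3); [| apply Hc].
  apply filter_forall. intro y. apply (@RInt_correct R_CompleteNormedModule).
  apply ex_RInt_continuous. intros; apply Hc.
Qed.

Lemma depth_tip : depth (1 / 3) = 0.
Proof. apply (@RInt_point R_CompleteNormedModule). Qed.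

(** Each identity for [depth] below comes from comparing it with another primitive of [slope]. *)
Lemma derive_diff (f g df : R -> R) (a b : R) : a <= b ->
  (forall x, a <= x <= b -> is_derive f x (df x)) ->
  (forall x, a <= x <= b -> is_derive g x (df x)) ->
  f b - g b = f a - g a.
Proof.
  intros Hab Hf Hg. destruct (Req_dec a b) as [-> | Hne]. { reflexivity. }
  symmetry. apply (eq_is_derive (fun x => f x - g x)); [| lra].
  intros t Ht. change zero with 0. replace 0 with (df t - df t) by ring.
  apply (is_derive_minus (V := R_NormedModule) f g); auto.
Qed.

(** By the chain rule and [slope_eq] both sides are primitives of [slope] here, and both vanish at
    1/3, which x |-> 1 - 2x fixes. *)
Lemma depth_eq x : x <= 1 / 2 -> depth x = depth (1 - 2 * x) / 4.
Proof.
  intro Hx.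
  assert (Hd : forall y, y <= 1 / 2 ->
    is_derive (fun y => depth (1 - 2 * y) / 4) y (slope y)).
  { intros y Hy. rewrite slope_eq, tent_left by lra.
    apply is_derive_ext with (fun t => / 4 * depth (1 - 2 * t)). { intro t. apply Rmult_comm. }
    replace (0 - slope (1 - 2 * y) / 2) with (/ 4 * (-2 * slope (1 - 2 * y))) by field.
    apply is_derive_scal. apply (is_derive_comp (V := R_NormedModule) depth).
    { apply is_derive_depth. }
    auto_derive; [exact I | ring]. }
  assert (E0 : depth (1 - 2 * (1 / 3)) = 0).
  { replace (1 - 2 * (1 / 3)) with (1 / 3) by field. apply depth_tip. }
  pose proof depth_tip as E1.
  destruct (Rle_dec x (1 / 3)).
  - pose proof (derive_diff depth (fun y => depth (1 - 2 * y) / 4) slope x (1 / 3)) as E.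
    cbv beta in E. rewrite E0, E1 in E.
    assert (0 - 0 / 4 = depth x - depth (1 - 2 * x) / 4); [| lra].
    apply E. { lra. } { intros; apply is_derive_depth. } { intros; apply Hd; lra. }
  - pose proof (derive_diff depth (fun y => depth (1 - 2 * y) / 4) slope (1 / 3) x) as E.
    cbv beta in E. rewrite E0, E1 in E.
    assert (depth x - depth (1 - 2 * x) / 4 = 0 - 0 / 4); [| lra].
    apply E. { lra. } { intros; apply is_derive_depth. } { intros; apply Hd; lra. }
Qed.

Lemma depth_affine_diff x : 7 / 12 <= x <= 1 -> depth 1 - depth x = 2 * (1 - x).
Proof.
  intro Hx.
  pose proof (derive_diff depth (fun y => 2 * y) slope x 1) as E. cbv beta in E.
  assert (depth 1 - 2 * 1 = depth x - 2 * x); [| lra].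
  apply E. { lra. } { intros; apply is_derive_depth. }
  intros y Hy. rewrite slope_right by lra.
  replace (Rmax _ _) with 2 by minmax. auto_derive; [exact I | ring].
Qed.

Lemma depth_parabolic_diff : depth (7 / 12) - depth (1 / 2) = 5 / 48.
Proof.
  pose proof (derive_diff depth (fun y => 9 * (y * y) - 17 / 2 * y) slope (1 / 2) (7 / 12)) as E.
  cbv beta in E.
  assert (depth (7 / 12) - (9 * (7 / 12 * (7 / 12)) - 17 / 2 * (7 / 12)) =
    depth (1 / 2) - (9 * (1 / 2 * (1 / 2)) - 17 / 2 * (1 / 2))); [| lra].
  apply E. { lra. } { intros; apply is_derive_depth. }
  intros y Hy. rewrite slope_right by lra.
  replace (Rmax _ _) with (18 * y - 17 / 2) by minmax. auto_derive; [exact I | ring].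
Qed.

(** Two uses of [depth_eq] give [depth (1 / 2)] = [depth 1] / 16, while integrating [slope] over
    [1/2,1] gives 5/48 + 5/6 = 15/16 for the difference. *)
Lemma depth_0_1 : depth 0 = 1 / 4 /\ depth 1 = 1.
Proof.
  pose proof (depth_eq 0 ltac:(lra)) as E0. pose proof (depth_eq (1 / 2) ltac:(lra)) as E1.
  replace (1 - 2 * 0) with 1 in E0 by ring. replace (1 - 2 * (1 / 2)) with 0 in E1 by field.
  pose proof depth_parabolic_diff. pose proof (depth_affine_diff (7 / 12) ltac:(lra)). lra.
Qed.

Lemma depth_affine x : 7 / 12 <= x <= 1 -> depth x = 2 * x - 1.
Proof. intro Hx. pose proof (depth_affine_diff x Hx). destruct depth_0_1. lra. Qed.

Lemma depth_continuity x : continuity_pt depth x.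
Proof.
  apply derivable_continuous_pt. exists (slope x).
  apply is_derive_Reals, is_derive_depth.
Qed.

Lemma depth_increasing x y : 1 / 3 <= x <= y -> depth x <= depth y.
Proof.
  intro Hxy. destruct (MVT_gen depth x y slope) as [z [Hz E]].
  - intros; apply is_derive_depth.
  - intros; apply depth_continuity.
  - rewrite Rmin_left, Rmax_right in Hz by lra.
    pose proof (slope_nonneg z ltac:(lra)). nra.
Qed.

Lemma depth_bounds x : I01 x -> 0 <= depth x <= 1.
Proof.
  intros [H0 H1].
  assert (B : forall y, 1 / 3 <= y <= 1 -> 0 <= depth y <= 1).
  { intros y Hy. pose proof depth_tip. destruct depth_0_1.
    pose proof (depth_increasing (1 / 3) y). pose proof (depth_increasing y 1). lra. }
  destruct (Rle_dec (1 / 3) x). { apply B. lra. }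
  rewrite depth_eq by lra. specialize (B (1 - 2 * x) ltac:(lra)). lra.
Qed.

(** This is surjectivity of I_0 onto I_1; the branch over [0,1/3] alone already covers all
    values. *)
Lemma depth_image y : 0 <= y <= 1 / 4 -> exists x, 0 <= x <= 1 / 2 /\ depth x = y.
Proof.
  intro Hy. destruct (IVT_gen depth 0 (1 / 3) y) as [x [Hx E]].
  - exact depth_continuity.
  - rewrite depth_tip, (proj1 depth_0_1). rewrite Rmin_right, Rmax_left; lra.
  - rewrite Rmin_left, Rmax_right in Hx by lra. exists x. split; [lra | exact E].
Qed.

(** * Derivatives within [0,1] and maps agreeing on [0,1] *)

Lemma D_in_ext (f g f' g' : R -> R) (D : R -> Prop) (x : R) :
  (forall y, D y -> f y = g y) -> D x -> f' x = g' x ->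
  D_in f f' D x -> D_in g g' D x.
Proof.
  intros Hfg Hx Hd H eps Heps. destruct (H eps Heps) as [a [Ha K]].
  exists a. split; [exact Ha |]. intros y [[Dy Hy] Hya].
  rewrite <- Hd, <- (Hfg x Hx), <- (Hfg y Dy). apply K. repeat split; assumption.
Qed.

Lemma D_in_I01_unique (f f1 f2 : R -> R) (x : R) :
  I01 x -> D_in f f1 I01 x -> D_in f f2 I01 x -> f1 x = f2 x.
Proof.
  intros [Hx0 Hx1] H1 H2. refine (single_limit _ _ _ _ _ _ H1 H2).
  intros a Ha. pose proof (Rmin_l (a / 2) (1 / 2)). pose proof (Rmin_r (a / 2) (1 / 2)).
  assert (0 < Rmin (a / 2) (1 / 2)) by (apply Rmin_pos; lra).
  (* Uniqueness needs nearby points of [0,1] other than x: a step of at most 1/2 towards the farther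
     endpoint stays inside. *)
  destruct (Rle_dec x (1 / 2)).
  - exists (x + Rmin (a / 2) (1 / 2)). unfold D_x, I01, segment, Rdist.
    replace (x + Rmin (a / 2) (1 / 2) - x) with (Rmin (a / 2) (1 / 2)) by ring.
    rewrite Rabs_pos_eq by lra. repeat split; try intro; lra.
  - exists (x - Rmin (a / 2) (1 / 2)). unfold D_x, I01, segment, Rdist.
    replace (x - Rmin (a / 2) (1 / 2) - x) with (- Rmin (a / 2) (1 / 2)) by ring.
    rewrite Rabs_Ropp, Rabs_pos_eq by lra. repeat split; try intro; lra.
Qed.

Lemma crit_unique (f : R -> R) (c : R) : unique (critical_point f) c -> crit f = c.
Proof.
  intros [Hc Hu]. symmetry. apply Hu. unfold crit. apply epsilon_spec. exists c. exact Hc.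
Qed.

(** The equation Rf = f is established only on [0,1], so iterating it requires every notion to be
    invariant under this relation. *)
Definition eq_on_I01 (f g : R -> R) : Prop := forall x, I01 x -> f x = g x.

Lemma eq_on_I01_sym (f g : R -> R) : eq_on_I01 f g -> eq_on_I01 g f.
Proof. intros H x Hx. symmetry. apply H, Hx. Qed.

Lemma critical_point_ext (f g : R -> R) (c : R) :
  eq_on_I01 f g -> critical_point f c -> critical_point g c.
Proof.
  intros Hfg [Hc HD]. split; [exact Hc |].
  assert (I01 c) by (unfold I01, segment; lra).
  apply D_in_ext with (3 := eq_refl) (4 := HD); assumption.
Qed.

Lemma unique_critical_point_ext (f g : R -> R) (c : R) :
  eq_on_I01 f g -> unique (critical_point f) c -> unique (critical_point g) c.
Proof.
  intros Hfg [Hc Hu]. split.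
  - exact (critical_point_ext f g c Hfg Hc).
  - intros c' Hc'. apply Hu. exact (critical_point_ext g f c' (eq_on_I01_sym f g Hfg) Hc').
Qed.

Lemma unimodal_ext (f g : R -> R) : eq_on_I01 f g -> unimodal f -> unimodal g.
Proof.
  intros Hfg [Hi [[f' [Hd Hc]] [H1 [c [Hu Hfc]]]]].
  assert (I01 1) by (unfold I01, segment; lra).
  assert (I01 c) by (destruct Hu as [[Hc01 _] _]; unfold I01, segment; lra).
  repeat split.
  1,2: rewrite <- Hfg by assumption; apply Hi; assumption.
  - exists f'. split; [| exact Hc]. intros x Hx.
    apply D_in_ext with (3 := eq_refl) (4 := Hd x Hx); assumption.
  - rewrite <- Hfg; assumption.
  - exists c. split; [exact (unique_critical_point_ext f g c Hfg Hu) |].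
    rewrite <- Hfg; assumption.
Qed.

Lemma crit_I01 (f : R -> R) : unimodal f -> I01 (crit f).
Proof.
  intros (_ & _ & _ & c & Hu & _). rewrite (crit_unique f c Hu).
  destruct Hu as [[Hc _] _]. unfold I01, segment. lra.
Qed.

Lemma crit_ext (f g : R -> R) : eq_on_I01 f g -> unimodal f -> crit g = crit f.
Proof.
  intros Hfg (_ & _ & _ & c & Hu & _). rewrite (crit_unique f c Hu).
  apply crit_unique, (unique_critical_point_ext f g c Hfg Hu).
Qed.

Lemma crit_orbit_I01 (f : R -> R) (k : nat) : unimodal f -> I01 (crit_orbit f k).
Proof.
  intro Hf. induction k as [|k IH]; [exact (crit_I01 f Hf) |].
  apply (proj1 Hf), IH.
Qed.

Lemma crit_orbit_ext (f g : R -> R) (k : nat) :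
  eq_on_I01 f g -> unimodal f -> crit_orbit g k = crit_orbit f k.
Proof.
  intros Hfg Hf. induction k as [|k IH]; [exact (crit_ext f g Hfg Hf) |].
  change (g (crit_orbit g k) = f (crit_orbit f k)).
  rewrite IH. symmetry. apply Hfg, crit_orbit_I01, Hf.
Qed.

Lemma quadratic_tip_ext (f g : R -> R) :
  eq_on_I01 f g -> unimodal f -> quadratic_tip f -> quadratic_tip g.
Proof.
  intros Hfg Hf (x & A & HA & Hx & Hcv & Hq). exists x, A. rewrite (crit_ext f g Hfg Hf).
  repeat split; try assumption; try apply Hx.
  intros eps Heps. destruct (Hq eps Heps) as [N HN]. exists N. intros n Hn.
  rewrite <- (Hfg (x n)) by apply Hx. rewrite <- (Hfg (crit f)) by apply crit_I01, Hf.
  apply HN, Hn.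
Qed.

Lemma renormalizable_ext (f g : R -> R) :
  eq_on_I01 f g -> renormalizable f -> renormalizable g.
Proof.
  intros Hfg (Hf & Hq & Hc & [Him1 Him2] & Hd).
  assert (E0 : I0 g = I0 f) by (unfold I0; rewrite !(crit_orbit_ext f g) by assumption; reflexivity).
  assert (E1 : I1 g = I1 f) by (unfold I1; rewrite !(crit_orbit_ext f g) by assumption; reflexivity).
  assert (H0 : forall x, I0 f x -> I01 x).
  { intros x [Hl Hr]. pose proof (crit_orbit_I01 f 2 Hf) as [B2 _].
    pose proof (crit_orbit_I01 f 4 Hf) as [_ B4]. unfold I01, segment. lra. }
  unfold renormalizable. rewrite E0, E1, (crit_ext f g Hfg Hf).
  split; [exact (unimodal_ext f g Hfg Hf) |].
  split; [exact (quadratic_tip_ext f g Hfg Hf Hq) |].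
  split; [exact Hc |]. split; [| exact Hd]. split.
  - intros y [x [-> Hx]]. apply Him1. exists x. split; [| exact Hx].
    symmetry. apply Hfg, H0, Hx.
  - intros y Hy. destruct (Him2 y Hy) as [x [-> Hx]]. exists x. split; [| exact Hx].
    apply Hfg, H0, Hx.
Qed.

Lemma flip_I01 (a b x : R) : I01 a -> I01 b -> I01 x -> I01 (flip a b x).
Proof. unfold I01, segment, flip. intros. nra. Qed.

Lemma renormalization_ext (f g : R -> R) : eq_on_I01 f g -> unimodal f ->
  eq_on_I01 (renormalization f) (renormalization g).
Proof.
  intros Hfg Hf x Hx. unfold renormalization. rewrite !(crit_orbit_ext f g) by assumption.
  assert (Hy : I01 (flip (crit_orbit f 2) (crit_orbit f 4) x))
    by (apply flip_I01; try apply crit_orbit_I01; assumption).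
  rewrite <- (Hfg _ Hy), <- Hfg; [reflexivity |]. apply (proj1 Hf), Hy.
Qed.

(** By induction every iterate of R agrees with f on [0,1], and renormalizability passes along that
    agreement. *)
Lemma fixed_infinitely_renormalizable (f : R -> R) :
  renormalizable f -> eq_on_I01 (renormalization f) f -> infinitely_renormalizable f.
Proof.
  intros Hr Hfix n. apply renormalizable_ext with f; [| exact Hr].
  induction n as [|n IH]; [intros x _; reflexivity |].
  intros x Hx. rewrite <- (Hfix x Hx). apply (renormalization_ext _ _ IH); [apply Hr | exact Hx].
Qed.

(** * Unimodality, quadratic tip and renormalization of the fixed map *)

Lemma derivative_map_fix : derivative_on_I01 map_fix (fun x => - slope x).
Proof.
  intros x _ eps Heps.
  assert (Hd : derivable_pt_lim map_fix x (- slope x)).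
  { apply is_derive_Reals. unfold map_fix.
    replace (- slope x) with (0 - slope x) by ring.
    apply (is_derive_minus (V := R_NormedModule) (fun _ => 1) depth).
    - apply (@is_derive_const R_AbsRing R_NormedModule).
    - apply is_derive_depth. }
  apply (derivable_pt_lim_D_in map_fix (fun x => - slope x)) in Hd.
  destruct (Hd eps Heps) as [a [Ha K]]. exists a. split; [exact Ha |].
  intros y [[_ Hy] Hya]. apply K. repeat split; assumption.
Qed.

Lemma critical_point_map_fix : unique (critical_point map_fix) (1 / 3).
Proof.
  pose proof slope_tip as S0. split.
  - split; [lra |].
    apply D_in_ext with (f := map_fix) (f' := fun x => - slope x).
    + reflexivity.
    + unfold I01, segment; lra.
    + lra.
    + apply derivative_map_fix. unfold I01, segment; lra.
  - intros c [Hc HD]. assert (I01 c) by (unfold I01, segment; lra).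
    pose proof (D_in_I01_unique _ _ _ c H HD (derivative_map_fix c H)) as E.
    (* A zero of [slope] at c forces 3(c - 1/3)^2 <= 0. *)
    cbv beta in E. pose proof (slope_sign c). nra.
Qed.

Lemma map_fix_C1_Lip : class_C1_Lip map_fix.
Proof.
  exists (fun x => - slope x). split; [exact derivative_map_fix |].
  exists 18. intros x y _ _. replace (- slope x - - slope y) with (slope y - slope x) by ring.
  rewrite (Rabs_minus_sym x). apply slope_Lipschitz.
Qed.

Lemma map_fix_unimodal : unimodal map_fix.
Proof.
  split; [| split; [| split]].
  - intros x Hx. pose proof (depth_bounds x Hx). unfold I01, segment, map_fix. lra.
  - exists (fun x => - slope x). split; [exact derivative_map_fix |].
    intros x _ eps Heps.
    destruct (continuity_pt_opp _ _ (slope_continuity x) eps Heps) as [a [Ha K]].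
    exists a. split; [exact Ha |]. intros y [[_ Hy] Hya]. apply K. repeat split; assumption.
  - unfold map_fix. destruct depth_0_1. lra.
  - exists (1 / 3). split; [exact critical_point_map_fix |].
    unfold map_fix. rewrite depth_tip. ring.
Qed.

Lemma crit_map_fix : crit map_fix = 1 / 3.
Proof. apply crit_unique, critical_point_map_fix. Qed.

Lemma crit_orbit_map_fix :
  crit_orbit map_fix 1 = 1 /\ crit_orbit map_fix 2 = 0 /\
  crit_orbit map_fix 3 = 3 / 4 /\ crit_orbit map_fix 4 = 1 / 2.
Proof.
  destruct depth_0_1 as [D0 D1]. unfold crit_orbit, map_fix. simpl. fold map_fix.
  rewrite crit_map_fix, depth_tip, Rminus_0_r, D1, Rminus_diag, D0.
  rewrite depth_affine by lra. lra.
Qed.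

Lemma map_fix_quadratic_tip : quadratic_tip map_fix.
Proof.
  unfold quadratic_tip. rewrite crit_map_fix.
  (* These displacements start at the point 1 and follow its preimages under x |-> 1 - 2x towards
     1/3. *)
  set (t := fun n => 2 / 3 * (- (1 / 2)) ^ n).
  assert (Ht : forall n, -1 / 3 <= t n <= 2 / 3 /\ t n <> 0).
  { intro n. unfold t. induction n as [|n [IH IH0]]; simpl; [lra |]. split; nra. }
  (* Both sides are divided by 4 at each step; 9/4 is fixed by [depth 1 = 1] at displacement 2/3. *)
  assert (Hg : forall n, depth (1 / 3 + t n) = 9 / 4 * (t n) ^ 2).
  { induction n as [|n IH].
    - unfold t. simpl. replace (1 / 3 + 2 / 3 * 1) with 1 by field.
      rewrite (proj2 depth_0_1). field.
    - assert (E : t (S n) = - (1 / 2) * t n) by (unfold t; simpl; ring).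
      destruct (Ht n). rewrite depth_eq by lra.
      replace (1 - 2 * (1 / 3 + t (S n))) with (1 / 3 + t n) by lra.
      rewrite IH, E. field. }
  exists (fun n => 1 / 3 + t n), (9 / 4). split; [lra |]. split; [| split].
  - intro n. destruct (Ht n). unfold I01, segment. split; lra.
  - apply is_lim_seq_Reals. replace (Finite (1 / 3)) with (Finite (1 / 3 + 2 / 3 * 0)) by (f_equal; ring).
    apply (is_lim_seq_plus' _ _ (1 / 3) (2 / 3 * 0)); [apply is_lim_seq_const |].
    apply (is_lim_seq_scal_l _ (2 / 3) 0), is_lim_seq_geom.
    rewrite Rabs_Ropp, Rabs_pos_eq; lra.
  - apply is_lim_seq_Reals. apply is_lim_seq_ext with (fun _ => - (9 / 4)).
    + intro n. unfold map_fix. rewrite Hg, depth_tip. destruct (Ht n). field. lra.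
    + apply is_lim_seq_const.
Qed.

Lemma map_fix_renormalizable : renormalizable map_fix.
Proof.
  destruct crit_orbit_map_fix as (E1 & E2 & E3 & E4).
  split; [exact map_fix_unimodal |]. split; [exact map_fix_quadratic_tip |].
  unfold I0, I1. rewrite E1, E2, E3, E4, crit_map_fix. unfold segment.
  split; [lra |]. split; [split |].
  - intros y [x [-> Hx]]. unfold map_fix. rewrite depth_eq by lra.
    pose proof (depth_bounds (1 - 2 * x) ltac:(unfold I01, segment; lra)). lra.
  - intros y Hy. destruct (depth_image (1 - y) ltac:(lra)) as [x [Hx E]].
    exists x. unfold map_fix. rewrite E. split; [ring | exact Hx].
  - intros [x [H0 H1]]. lra.
Qed.

(** The first application of the map sends the flipped point to 1 - [depth x] / 4, in [3/4,1]; there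
    the map is y |-> 2 - 2y, giving [depth x] / 2, which [flip_inv] turns into 1 - [depth x]. *)
Lemma renormalization_map_fix : eq_on_I01 (renormalization map_fix) map_fix.
Proof.
  intros x Hx. destruct crit_orbit_map_fix as (_ & E2 & _ & E4).
  unfold renormalization. rewrite E2, E4. unfold flip, flip_inv, map_fix.
  pose proof (depth_bounds x Hx) as B. destruct Hx as [Hx0 Hx1].
  rewrite (depth_eq (1 / 2 - _)) by lra.
  replace (1 - 2 * (1 / 2 - (1 / 2 - 0) * x)) with x by field.
  rewrite depth_affine by lra. field.
Qed.

(** * Failure of C^2 at the kink *)

Lemma map_fix_not_C2 : ~ class_C 2 map_fix.
Proof.
  intros [f' [Hf' [f'' [Hf'' _]]]].
  (* The definition of C^2 only provides some derivative; uniqueness identifies it. *)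
  assert (E : forall x, I01 x -> f' x = - slope x).
  { intros x Hx. exact (D_in_I01_unique _ _ _ x Hx (Hf' x Hx) (derivative_map_fix x Hx)). }
  assert (Hk : I01 (7 / 12)) by (unfold I01, segment; lra).
  destruct (Hf'' (7 / 12) Hk 1 Rlt_0_1) as [a [Ha K]].
  (* The bound 1/12 keeps 7/12 - d in [1/2,1], where [slope] is explicit. The left quotient is then
     -18 and the right one 0, so they cannot both be within 1 of [f'' (7 / 12)]. *)
  set (d := Rmin (a / 2) (1 / 12)).
  assert (Hd : 0 < d <= 1 / 12 /\ d < a) by (unfold d; minmax).
  assert (Hl : I01 (7 / 12 - d)) by (unfold I01, segment; lra).
  assert (Hr : I01 (7 / 12 + d)) by (unfold I01, segment; lra).
  assert (K1 : Rabs ((f' (7 / 12 - d) - f' (7 / 12)) / (7 / 12 - d - 7 / 12) - f'' (7 / 12)) < 1).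
  { apply K. split; [split; [exact Hl | intro; lra] |].
    simpl. unfold Rdist. replace (7 / 12 - d - 7 / 12) with (- d) by ring.
    rewrite Rabs_Ropp, Rabs_pos_eq; lra. }
  assert (K2 : Rabs ((f' (7 / 12 + d) - f' (7 / 12)) / (7 / 12 + d - 7 / 12) - f'' (7 / 12)) < 1).
  { apply K. split; [split; [exact Hr | intro; lra] |].
    simpl. unfold Rdist. replace (7 / 12 + d - 7 / 12) with d by ring.
    rewrite Rabs_pos_eq; lra. }
  rewrite !E, !slope_right in K1, K2 by (assumption || lra).
  replace (Rmax _ _) with 2 in K2 by minmax.
  replace (Rmax (3 * (7 / 12) - 1) _) with 2 in K1, K2 by minmax.
  replace (Rmax _ _) with (2 - 18 * d) in K1 by minmax.
  replace ((- (2 - 18 * d) - - (2)) / (7 / 12 - d - 7 / 12)) with (-18) in K1 by (field; lra).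
  replace ((- (2) - - (2)) / (7 / 12 + d - 7 / 12)) with 0 in K2 by (field; lra).
  apply Rabs_def2 in K1. apply Rabs_def2 in K2. lra.
Qed.

Theorem theorem1p6 :
  exists f : R -> R,
    unimodal f /\
    class_C1_Lip f /\
    quadratic_tip f /\
    infinitely_renormalizable f /\
    ~ class_C 2 f /\
    (forall x : R, I01 x -> renormalization f x = f x).
Proof.
  exists map_fix. split; [exact map_fix_unimodal |]. split; [exact map_fix_C1_Lip |].
  split; [exact map_fix_quadratic_tip |].
  split; [exact (fixed_infinitely_renormalizable _ map_fix_renormalizable renormalization_map_fix) |].
  split; [exact map_fix_not_C2 | exact renormalization_map_fix].
Qed.
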